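(* Let $X$, $Y$ be Banach spaces and let $G\in L(X,Y)$. Then $G$ has the alternative Daugavet property if and only if for all separable subspaces $X_0\subset X$ and $Y_0\subset Y$ there exist separable subspaces $X_\infty$, $Y_\infty$ satisfying $X_0\subset X_\infty\subset X$ and $Y_0\subset Y_\infty\subset Y$ and such that $G(X_\infty)\subset Y_\infty$ and $G|_{X_\infty}:X_\infty\to Y_\infty$ has the alternative Daugavet property.
   Context: Scalars are $\mathbb{K}=\mathbb{R}$ or $\mathbb{C}$; $\mathbb{T}=\{\omega\in\mathbb{K}:|\omega|=1\}$; subspaces are closed. $G\in L(X,Y)$ has the alternative Daugavet property if $\sup_{\omega\in\mathbb{T}}\|G+\omega T\|=1+\|T\|$ for every rank-one $T\in L(X,Y)$ (including $T=0$, so that $\|G\|=1$). *)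

(* Defs.v *)
From HB Require Import structures.
From mathcomp Require Import all_boot all_order all_algebra.
From mathcomp Require Import complex.
From mathcomp Require Import boolp classical_sets cardinality reals.
From mathcomp Require Import topology tvs normedtype.

Set Implicit Arguments.
Unset Strict Implicit.
Unset Printing Implicit Defensive.

Import Order.TTheory GRing.Theory Num.Theory.
Import numFieldNormedType.Exports.

Local Open Scope classical_set_scope.
Local Open Scope ring_scope.

Variant scalar_kind := RealScalars | ComplexScalars.

Definition scalars (R : realType) (k : scalar_kind) : numFieldType :=
  match k with
  | RealScalars => R : numFieldType
  | ComplexScalars => complex R : numFieldType
  end.

Definition separable (T : topologicalType) : Prop :=
  exists2 D : set T, countable D & dense D.

(* L(X, Y) *)
Record bounded_op (K : numFieldType) (X Y : normedModType K) := BoundedOp {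
  bop_linear :> {linear X -> Y};
  bop_continuous : continuous bop_linear }.

(* The supremum is taken in the order of K. When K is the field of complex
   numbers this order is partial, but every upper bound of a nonempty set of
   nonnegative elements is itself a nonnegative real number, so that the
   supremum of a bounded set of norms is the usual one. *)
Definition opnorm (K : numFieldType) (X Y : normedModType K) (f : X -> Y) : K :=
  supremum 0 [set `|f x| | x in [set x : X | `|x| <= 1]].

Definition rank_le_one (K : numFieldType) (X Y : normedModType K) (f : X -> Y) :
    Prop :=
  exists y : Y, forall x : X, exists c : K, f x = c *: y.

Definition alternative_Daugavet (K : numFieldType) (X Y : normedModType K)
    (G : bounded_op X Y) : Prop :=
  forall T : bounded_op X Y, rank_le_one T ->
    supremum 0 [set opnorm (G \+ w \*: T) | w in [set w : K | `|w| = 1]]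
    = 1 + opnorm T.

Record closed_subspace (K : numFieldType) (X : normedModType K) :=
  ClosedSubspace {
    subspace_set : set X;
    subspace_submod : submod_closed (mem subspace_set);
    subspace_closed : closed subspace_set }.

Section SubspaceType.
Variables (K : numFieldType) (X : normedModType K) (S : closed_subspace X).

Definition subspace_pred : {pred X} := mem (subspace_set S).

HB.instance Definition _ :=
  GRing.isSubmodClosed.Build K X subspace_pred (subspace_submod S).

Record subspace_type := SubspaceElt {
  subspace_val :> X;
  subspace_valP : subspace_val \in subspace_pred }.

HB.instance Definition _ := [isSub of subspace_type for subspace_val].
HB.instance Definition _ := [Choice of subspace_type by <:].
HB.instance Definition _ := [SubChoice_isSubLmodule of subspace_type by <:].

Definition subspace_norm (x : subspace_type) : K := `|subspace_val x|.

Lemma subspace_normD (x y : subspace_type) :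
  subspace_norm (x + y) <= subspace_norm x + subspace_norm y.
Proof. exact: ler_normD. Qed.

Lemma subspace_normZ (a : K) (x : subspace_type) :
  subspace_norm (a *: x) = `|a| * subspace_norm x.
Proof. exact: normrZ. Qed.

Lemma subspace_norm0_eq0 (x : subspace_type) : subspace_norm x = 0 -> x = 0.
Proof. by move=> /normr0_eq0 x0; apply: val_inj. Qed.

HB.instance Definition _ := Lmodule_isNormed.Build K subspace_type
  subspace_normD subspace_normZ subspace_norm0_eq0.

End SubspaceType.

Coercion subspace_type : closed_subspace >-> Sortclass.

Section Restriction.
Variables (K : numFieldType) (X Y : normedModType K) (G : bounded_op X Y).
Variables (S : closed_subspace X) (S' : closed_subspace Y).
Hypothesis GS : G @` subspace_set S `<=` subspace_set S'.

Lemma restrict_subproof (x : S) : G (subspace_val x) \in subspace_pred S'.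
Proof.
by apply/mem_set/GS; exists (subspace_val x) => //; exact/set_mem/subspace_valP.
Qed.

Definition restrict_fun (x : S) : S' := SubspaceElt (restrict_subproof x).

Lemma restrict_linear : linear restrict_fun.
Proof. by move=> a x y; apply: val_inj; rewrite /= linearP. Qed.

HB.instance Definition _ :=
  GRing.isLinear.Build K S S' _ restrict_fun restrict_linear.

Lemma restrict_continuous : continuous restrict_fun.
Proof.
apply: bounded_linear_continuous; apply/linear_boundedP.
have /linear_boundedP GB := continuous_linear_bounded 0 (@bop_continuous _ _ _ G 0).
by apply: filterS GB => r Gr x; exact: Gr.
Qed.

Definition restrict : bounded_op S S' := BoundedOp restrict_continuous.

End Restriction.

(* Main.v *)
(* An absolutely convex reformulation of the property, free of functionals,
   passes to separable subspaces. [G] has the alternative Daugavet property if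
   and only if [G] has norm 1 and, for all [y != 0] and [e > 0], the absolutely
   convex hull of
     { z in the unit ball | |G z + w y| > 1 + |y| - e for some |w| = 1 }
   is dense in the unit ball. If it were not dense, Hahn-Banach would give a
   functional [F] with |F| <= 1 on this set and norm greater than 1, and the
   rank-one operator [F(.) y] would violate the property. Conversely, given a
   rank-one [T] and [u] in the unit ball, approximate [u] by an absolutely
   convex combination of such [z] for [y = T u]: one of them satisfies
   |T z| >= |T u| - e', and this [z] is a witness for [T].
   Density involves only countably many finite combinations once [x] and [y]
   range over countable dense sets and [e] over the [1 / (n + 1)]; closing
   countable sets under the choice of these combinations, under [G] and under
   linear combinations yields the required subspaces. For the converse
   direction, apply the hypothesis to the spans of a point almost attaining the
   norm of [T] and of the range of [T]. *)
From HB Require Import structures.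
From mathcomp Require Import all_boot all_order all_algebra.
From mathcomp Require Import complex lra ring.
From mathcomp Require Import boolp classical_sets cardinality reals.
From mathcomp Require Import topology tvs normedtype.
Require Import Defs.

Set Implicit Arguments.
Unset Strict Implicit.
Unset Printing Implicit Defensive.

Import Order.TTheory GRing.Theory Num.Theory.
Import numFieldNormedType.Exports.

Local Open Scope classical_set_scope.
Local Open Scope ring_scope.

(** * Scalars *)

Section Scalars.
Variables (R : realType) (k : scalar_kind).
Local Notation K := (scalars R k).

Definition real_part : K -> R :=
  match k return scalars R k -> R with
  | RealScalars => fun x => x
  | ComplexScalars => fun z => complex.Re z
  end.

Definition of_real : R -> K :=
  match k return R -> scalars R k with
  | RealScalars => fun x => x
  | ComplexScalars => fun x => real_complex R x
  end.

Lemma of_realK r : real_part (of_real r) = r.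
Proof. by rewrite /real_part /of_real; case: k. Qed.

Lemma of_realD r s : of_real (r + s) = of_real r + of_real s.
Proof. by rewrite /of_real; case: k => //=; rewrite rmorphD. Qed.

Lemma of_realM r s : of_real (r * s) = of_real r * of_real s.
Proof. by rewrite /of_real; case: k => //=; rewrite rmorphM. Qed.

Lemma of_real0 : of_real 0 = 0.
Proof. by rewrite /of_real; case: k. Qed.

Lemma of_real1 : of_real 1 = 1.
Proof. by rewrite /of_real; case: k. Qed.

Lemma of_realB r s : of_real (r - s) = of_real r - of_real s.
Proof. by rewrite /of_real; case: k => //=; rewrite rmorphB. Qed.

Lemma ler_of_real r s : (of_real r <= of_real s) = (r <= s).
Proof. by rewrite /of_real; case: k => //=; rewrite lecR. Qed.

Lemma ltr_of_real r s : (of_real r < of_real s) = (r < s).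
Proof. by rewrite /of_real; case: k => //=; rewrite ltcR. Qed.

Lemma ge0_of_real x : 0 <= x -> of_real (real_part x) = x.
Proof.
move: x; rewrite /of_real /real_part; case: k => //= x x0.
by apply: RRe_real; exact: ger0_real.
Qed.


Lemma real_part_norm x : real_part x <= real_part `|x|.
Proof.
move: x; rewrite /real_part; case: k => /= x; first exact: ler_norm.
have := normc_ge_Re x; rewrite lecE => /andP[_]; apply: le_trans.
exact: ler_norm.
Qed.

(** Multiples by the [q n] will stand in for all scalar multiples when countable sets are closed up;
    a sequence, unlike a set, can index these operations. *)
Lemma countable_dense_scalars :
  exists q : nat -> K, forall c e, 0 < e ->
    exists n, real_part `|c - q n| < e.
Proof.
pose u n : rat := odflt 0 (unpickle n).
have uP (r e : R) : 0 < e -> exists n, `|r - ratr (u n)| < e.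
  move=> e0; have /rat_in_itvoo[q] : r - e < r + e by lra.
  rewrite in_itv /= => /andP[rq qr]; exists (pickle q).
  by rewrite /u pickleK /= ltr_norml; lra.
rewrite /real_part; case: k => /=.
  by exists (fun n => ratr (u n)) => c e; exact: uP.
pose v n : nat * nat := odflt (0%N, 0%N) (unpickle n).
exists (fun n => (ratr (u (v n).1) +i* ratr (u (v n).2))%C) => -[a b] e e0.
have e20 : 0 < e / 2 by lra.
have [[n nP] [m mP]] := (uP a _ e20, uP b _ e20).
exists (pickle (n, m)); rewrite /v pickleK /=.
move: nP mP; set c := ratr _; set d := ratr _ => ac bd.
have -> : e = Num.sqrt (e ^+ 2) by rewrite sqrtr_sqr gtr0_norm.
rewrite ltr_sqrt ?exprn_gt0 // -(real_normK (num_real (a - c))).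
rewrite -(real_normK (num_real (b - d))).
have := normr_ge0 (a - c); have := normr_ge0 (b - d); move: ac bd.
move: `|a - c| `|b - d| => x y *; nra.
Qed.

(* The norm as an element of [R]: [`|x|] itself lives in [K]. *)
Definition nrm (V : normedZmodType K) (x : V) : R := real_part `|x|.

Section Norm.
Variable V : normedZmodType K.
Implicit Types x y : V.

Lemma normE x : `|x| = of_real (nrm x).
Proof. by rewrite /nrm ge0_of_real. Qed.

Lemma nrm_ge0 x : 0 <= nrm x.
Proof. by rewrite -ler_of_real -normE of_real0. Qed.

Lemma nrm0 : nrm (0 : V) = 0.
Proof. by rewrite /nrm normr0 -of_real0 of_realK. Qed.

Lemma nrm_eq0 x : (nrm x == 0) = (x == 0).
Proof.
apply/eqP/eqP => [x0|->]; last exact: nrm0.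
by apply: normr0_eq0; rewrite normE x0 of_real0.
Qed.

Lemma nrm_gt0 x : (0 < nrm x) = (x != 0).
Proof. by rewrite lt_def nrm_ge0 andbT nrm_eq0. Qed.

Lemma nrmN x : nrm (- x) = nrm x.
Proof. by rewrite /nrm normrN. Qed.

Lemma nrmB x y : nrm (x - y) = nrm (y - x).
Proof. by rewrite /nrm distrC. Qed.

Lemma ler_nrmD x y : nrm (x + y) <= nrm x + nrm y.
Proof. by rewrite -ler_of_real of_realD -!normE ler_normD. Qed.

Lemma lerB_nrm x y : nrm x - nrm y <= nrm (x - y).
Proof. by rewrite lerBlDr -{1}(subrK y x) ler_nrmD. Qed.

End Norm.

Lemma nrmM (a b : K) : nrm (a * b) = nrm a * nrm b.
Proof. by rewrite {1}/nrm normrM !normE -of_realM of_realK. Qed.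

Lemma nrm1 : nrm (1 : K) = 1.
Proof. by rewrite /nrm normr1 -of_real1 of_realK. Qed.

Lemma nrmV (a : K) : nrm a^-1 = (nrm a)^-1.
Proof.
have [->|a0] := eqVneq a 0; first by rewrite invr0 nrm0 invr0.
have na0 : nrm a != 0 by rewrite nrm_eq0.
by apply: (mulfI na0); rewrite -nrmM !mulfV // nrm1.
Qed.

Lemma nrm_of_real r : nrm (of_real r) = `|r|.
Proof.
have [r0|r0] := leP 0 r.
  have r0' : 0 <= of_real r by rewrite -of_real0 ler_of_real.
  by rewrite /nrm (ger0_norm r0') of_realK ger0_norm.
have r0' : of_real r <= 0 by rewrite -of_real0 ler_of_real ltW.
rewrite /nrm ler0_norm // (ltr0_norm r0).
rewrite -[RHS](of_realK); congr real_part.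
by apply/eqP; rewrite eq_sym -addr_eq0 -of_realD addNr of_real0.
Qed.

(** The phase [u] can be absorbed into the rotations [w] of the property, which leaves a nonnegative
    factor to estimate. *)
Lemma polar_decomposition (a : K) :
  exists2 u : K, nrm u = 1 & a = of_real (nrm a) * u.
Proof.
have [->|a0] := eqVneq a 0; first by exists 1; rewrite ?nrm1 // nrm0 of_real0 mul0r.
have na0 : 0 < nrm a by rewrite nrm_gt0.
exists (of_real (nrm a)^-1 * a).
  by rewrite nrmM nrm_of_real gtr0_norm ?invr_gt0 // mulVf ?gt_eqF.
by rewrite mulrA -of_realM mulfV ?gt_eqF // of_real1 mul1r.
Qed.

Lemma nrmZ (V : normedModType K) (a : K) (x : V) : nrm (a *: x) = nrm a * nrm x.
Proof. by rewrite {1}/nrm normrZ !normE -of_realM of_realK. Qed.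

(** An upper bound in [K] dominates some nonnegative element, so it is itself real and nonnegative;
    comparisons in the possibly partial order of [K] thus reduce to comparisons in [R]. *)
Lemma supremum_of_real (A : set K) (M : R) : A !=set0 ->
  (forall a, A a -> 0 <= a) -> (forall a, A a -> real_part a <= M) ->
  supremum 0 A = of_real (sup [set real_part a | a in A]).
Proof.
move=> A0 Age0 AM; set s := sup _.
have rA0 : [set real_part a | a in A] !=set0.
  by case: A0 => a Aa; exists (real_part a), a.
have rAs : has_sup [set real_part a | a in A].
  by split=> //; exists M => _ [a Aa <-]; exact: AM.
have sA : supremums A (of_real s).
  split=> [a Aa|u uA].
    rewrite -(ge0_of_real (Age0 _ Aa)) ler_of_real.
    by apply: ub_le_sup => //; [case: rAs|exists a].
  have u0 : 0 <= u by case: A0 => a Aa; exact: le_trans (Age0 _ Aa) (uA _ Aa).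
  rewrite -(ge0_of_real u0) ler_of_real; apply: ge_sup => // _ [a Aa <-].
by rewrite -ler_of_real (ge0_of_real u0) (ge0_of_real (Age0 _ Aa)) uA.
(* [supremum] selects a point of [supremums A], which has at most one. *)
rewrite /supremum ifN; last exact/set0P.
by apply: (@is_subset1_supremums _ _ A) => //; apply: xgetI sA.
Qed.

End Scalars.

(** * The Hahn-Banach theorem *)

Section HahnBanach.
Variables (R : realType) (k : scalar_kind) (V : lmodType (scalars R k)).
Local Notation K := (scalars R k).

(** Homogeneity is required as an inequality only: scaling back by the inverse of [r] turns it into
    the equality [sublinearZE]. *)
Record sublinear (q : V -> R) : Prop := Sublinear {
  sublinearD : forall x y, q (x + y) <= q x + q y;
  sublinearZ : forall r x, 0 < r -> q (of_real k r *: x) <= r * q x }.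

Lemma sublinear0 q : sublinear q -> q 0 = 0.
Proof.
move=> [_ qZ]; have h0 : (0 : R) < 1 / 2 by lra.
have := qZ 2 0 (ltr0n _ 2); have := qZ _ 0 h0; rewrite !scaler0; lra.
Qed.

Lemma sublinearZE q r x : sublinear q -> 0 <= r ->
  q (of_real k r *: x) = r * q x.
Proof.
move=> ql; rewrite le_eqVlt => /predU1P[<-|r0].
  by rewrite of_real0 scale0r mul0r (sublinear0 ql).
apply: le_anti; rewrite (sublinearZ ql) //= -ler_pdivlMl //.
rewrite -{1}(scale1r x) -(of_real1 R k) -(mulVf (lt0r_neq0 r0)) of_realM -scalerA.
by apply: sublinearZ; rewrite ?invr_gt0.
Qed.

(* Given [q] sublinear, [tilt q y] lies below [q] and has value at most [- q y]
   at [- y]; a minimal [q] is therefore additive. *)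
Definition tilt (q : V -> R) (y x : V) : R :=
  inf [set q (x + of_real k t *: y) - t * q y | t in [set t | 0 <= t]].

Section Tilt.
Variables (q : V -> R) (y : V).
Hypothesis ql : sublinear q.

Lemma tilt_ub x t : 0 <= t -> tilt q y x <= q (x + of_real k t *: y) - t * q y.
Proof.
move=> t0; apply: ge_inf; last by exists t.
(* Lower bound: s q(y) = q(s y) <= q(x + s y) + q(- x). *)
exists (- q (- x)) => _ [s /= s0 <-]; rewrite -(sublinearZE _ ql s0).
have := sublinearD ql (x + of_real k s *: y) (- x).
by rewrite addrAC subrr add0r; lra.
Qed.

Lemma tilt_adherent x e : 0 < e ->
  exists2 t, 0 <= t & q (x + of_real k t *: y) - t * q y < tilt q y x + e.
Proof.
rewrite -(ltrDl (tilt q y x)) => /inf_lt[|_ [t /= t0 <-] tc]; last by exists t.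
by exists (q (x + of_real k 0 *: y) - 0 * q y), 0 => /=.
Qed.

Lemma tilt_le x : tilt q y x <= q x.
Proof.
by have := tilt_ub x (lexx 0); rewrite of_real0 scale0r addr0 mul0r subr0.
Qed.

Lemma tiltN : tilt q y (- y) <= - q y.
Proof.
have := tilt_ub (- y) ler01.
by rewrite of_real1 scale1r addNr (sublinear0 ql) sub0r mul1r.
Qed.

(** If [t] and [s] are nearly optimal for [x] and [z], then [t + s] is a candidate for [x + z], and
    [r * t] is one for the multiple of [x] by [r]. *)
Lemma tilt_sublinear : sublinear (tilt q y).
Proof.
split=> [x z|r x r0].
  apply/ler_addgt0Pr => e e0; have e20 : 0 < e / 2 by lra.
  have [t t0 tP] := tilt_adherent x e20.
  have [s s0 sP] := tilt_adherent z e20.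
  apply: le_trans (tilt_ub _ (addr_ge0 t0 s0)) _.
  have := sublinearD ql (x + of_real k t *: y) (z + of_real k s *: y).
  by rewrite addrACA -scalerDl -of_realD; lra.
rewrite -ler_pdivrMl //; apply/ler_addgt0Pr => e e0.
have [t t0 tP] := tilt_adherent x e0.
rewrite ler_pdivrMl //; apply: le_trans (tilt_ub _ (mulr_ge0 (ltW r0) t0)) _.
rewrite of_realM -scalerA -scalerDr (sublinearZE _ ql (ltW r0)).
by rewrite -mulrA -mulrBr ler_pM2l // ltW.
Qed.

End Tilt.

(** Zorn's lemma for the sublinear functionals below [p], in the reversed pointwise order. *)
Lemma sublinear_minimal (p : V -> R) : sublinear p ->
  exists q, [/\ sublinear q, forall x, q x <= p x &
    forall s, sublinear s -> (forall x, s x <= q x) -> forall x, q x <= s x].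
Proof.
move=> pl; pose S := {q : V -> R | sublinear q /\ forall x, q x <= p x}.
pose rel (s t : S) := `[< forall x, sval t x <= sval s x >].
have pS : sublinear p /\ forall x, p x <= p x by split.
have [|s t u /asboolP st /asboolP tu|A Atot|] := @ZL_preorder S (exist _ p pS) rel.
- by move=> s; apply/asboolP.
- by apply/asboolP => x; exact: le_trans (tu x) (st x).
(* The empty chain is bounded by [p], any other by its pointwise infimum, which is finite since
   every member at [x] is at least [- p (- x)]. *)
- have [A0|/set0P[s0 As0]] := eqVneq A set0.
    by exists (exist _ p pS) => s; rewrite A0.
  pose I x := [set sval s x | s in A]; pose q x := inf (I x).
  have qub s x : A s -> q x <= sval s x.
    move=> As; apply: ge_inf; last by exists s.
    exists (- p (- x)) => _ [t _ <-]; have [tl tp] := svalP t.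
    have := sublinearD tl x (- x); rewrite subrr (sublinear0 tl).
    by have := tp (- x); lra.
  have qlt x e : 0 < e -> exists2 s, A s & sval s x < q x + e.
    rewrite -(ltrDl (q x)) => /inf_lt[|_ [t At <-] tc]; last by exists t.
    by exists (sval s0 x), s0.
  have ql : sublinear q.
    split=> [x y|r x r0].
      apply/ler_addgt0Pr => e e0; have e20 : 0 < e / 2 by lra.
      have [s As sx] := qlt x _ e20.
      have [t At ty] := qlt y _ e20.
      (* By totality of the chain, one of [s] and [t] lies below both. *)
      have [u [Au us ut]] : exists u, [/\ A u, rel s u & rel t u].
        have [st|ts] := Atot _ _ As At; [exists t|exists s]; split=> //;
        exact/asboolP.
      have := qub u (x + y) Au; have [ul _] := svalP u.
      have := sublinearD ul x y; move/asboolP: us => /(_ x).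
      by move/asboolP: ut => /(_ y); lra.
    rewrite -ler_pdivrMl //; apply/ler_addgt0Pr => e e0.
    have [s As sx] := qlt x _ e0.
    rewrite ler_pdivrMl //; apply: le_trans (qub s _ As) _.
    have [sl _] := svalP s.
    by rewrite (sublinearZE _ sl (ltW r0)) ler_pM2l // ltW.
  have qp x : q x <= p x by apply: le_trans (qub s0 x As0) _; case: (svalP s0).
  by exists (exist _ q (conj ql qp)) => s As; apply/asboolP => x /=; exact: qub.
move=> [q [ql qp]] qmin; exists q; split=> // s sl sq.
have sp x : s x <= p x by exact: le_trans (sq x) (qp x).
have /qmin/asboolP : rel (exist _ q (conj ql qp)) (exist _ s (conj sl sp)).
  exact/asboolP.
exact.
Qed.

(** Take [f] minimal below [tilt p x0] instead of [p]: this forces [f (- x0) <= - p x0], hence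
    equality at [x0]. Minimality against [tilt f y] gives [f x <= f (x + y) - f y], the missing half
    of additivity. *)
Lemma hahn_banach_real (p : V -> R) (x0 : V) : sublinear p ->
  exists f : V -> R,
    [/\ forall x y, f (x + y) = f x + f y,
        forall r x, f (of_real k r *: x) = r * f x,
        forall x, f x <= p x & f x0 = p x0].
Proof.
move=> pl; have [f [fl fp fmin]] := sublinear_minimal (tilt_sublinear x0 pl).
have fD x y : f (x + y) = f x + f y.
  apply: le_anti; rewrite (sublinearD fl) /=.
  have := fmin _ (tilt_sublinear y fl) (tilt_le y fl) x.
  by move=> /le_trans/(_ (tilt_ub y fl x ler01)); rewrite of_real1 scale1r mul1r; lra.
have fN x : f (- x) = - f x.
  by have := fD x (- x); rewrite subrr (sublinear0 fl); lra.
exists f; split=> // [r x|x|].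
- have [r0|r0] := leP 0 r; first exact: sublinearZE.
  have -> : of_real k r *: x = - (of_real k (- r) *: x).
    by apply/eqP; rewrite -addr_eq0 -scalerDl -of_realD subrr of_real0 scale0r.
  by rewrite fN (sublinearZE _ fl) ?mulNr ?opprK // oppr_ge0 ltW.
- exact: le_trans (fp x) (tilt_le x0 pl x).
- apply: le_anti; rewrite (le_trans (fp x0) (tilt_le x0 pl x0)) /=.
  by have := le_trans (fp (- x0)) (tiltN x0 pl); rewrite fN; lra.
Qed.

End HahnBanach.

Lemma linear_of_real_part (R : realType) (k : scalar_kind)
    (V : lmodType (scalars R k)) (f : V -> R) :
  (forall x y, f (x + y) = f x + f y) ->
  (forall r x, f (of_real k r *: x) = r * f x) ->
  exists2 F : V -> scalars R k,
    forall a x y, F (a *: x + y) = a * F x + F y & forall x, real_part (F x) = f x.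
Proof.
rewrite /of_real /real_part; case: k V f => /= V f fD fZ.
  by exists f => // a x y; rewrite fD fZ.
(* The imaginary part is forced: Im F(x) = - Re F(i x). *)
exists (fun x => f x +i* - f ('i%C *: x))%C => //= -[a b] x y.
have fE z : f ((a +i* b)%C *: z) = a * f z + b * f ('i%C *: z).
  rewrite -!fZ -fD scalerA -scalerDl; congr (f (_ *: z)).
  by rewrite {1}(complexE (a +i* b)%C) mulrC.
have -> : 'i%C *: ((a +i* b)%C *: x + y) = (a +i* b)%C *: ('i%C *: x) + 'i%C *: y.
  by rewrite scalerDr !scalerA mulrC.
rewrite !fD !fE scalerA -expr2 sqr_i scaleN1r.
have fN z : f (- z) = - f z.
  by apply/eqP; rewrite -addr_eq0 -fD addNr -(scale0r (0 : V)) (fZ 0) mul0r.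
by rewrite fN; congr Complex => /=; ring.
Qed.

Lemma hahn_banach (R : realType) (k : scalar_kind)
    (V : lmodType (scalars R k)) (p : V -> R) (x0 : V) :
  (forall x y, p (x + y) <= p x + p y) ->
  (forall a x, p (a *: x) <= nrm a * p x) ->
  exists F : V -> scalars R k,
    [/\ forall a x y, F (a *: x + y) = a * F x + F y,
        forall x, nrm (F x) <= p x & p x0 <= nrm (F x0)].
Proof.
move=> pD pZ; have pl : sublinear p.
  split=> // r x r0; apply: le_trans (pZ _ _) _.
  by rewrite nrm_of_real gtr0_norm.
have p_ge0 x : 0 <= p x.
  have := pD x (- x); rewrite subrr (sublinear0 pl).
  by have := pZ (-1) x; rewrite scaleN1r nrmN nrm1; lra.
have [f [fD fZ fp fx0]] := hahn_banach_real x0 pl.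
have [F FL Ff] := linear_of_real_part fD fZ; exists F; split=> // [x|]; last first.
  by rewrite -fx0 -Ff real_part_norm.
have [->|Fx0] := eqVneq (F x) 0; first by rewrite nrm0.
(* [u] rotates [F x] onto its modulus, so the bound on the real part at [u *: x] bounds the modulus
   at [x]. *)
pose u := of_real k (nrm (F x)) / F x.
have F0 : F 0 = 0.
  have := FL 1 0 0; rewrite scaler0 addr0 mul1r => F00.
  by apply: (addrI (F 0)); rewrite addr0 -F00.
have Fu : F (u *: x) = of_real k (nrm (F x)).
  by rewrite -(addr0 (u *: x)) FL F0 addr0 divfK.
rewrite -{1}(of_realK k (nrm (F x))) -Fu Ff.
apply: le_trans (fp _) (le_trans (pZ _ _) _).
rewrite nrmM nrmV nrm_of_real ger0_norm ?nrm_ge0 // mulfV ?nrm_eq0 //.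
by rewrite mul1r.
Qed.

(** * Operator norms *)

Section OperatorNorm.
Variables (R : realType) (k : scalar_kind) (X Y : normedModType (scalars R k)).
Local Notation K := (scalars R k).

Lemma bounded_op_nrm (T : bounded_op X Y) :
  exists2 M, 0 <= M & forall x, nrm (T x) <= M * nrm x.
Proof.
have /linear_boundedP/pinfty_ex_gt0[r r0 rP] :=
  continuous_linear_bounded 0 (@bop_continuous _ _ _ T 0).
have rE := ge0_of_real (ltW r0); exists (real_part r) => [|x].
  by rewrite -(ler_of_real k) rE of_real0 ltW.
by rewrite -(ler_of_real k) of_realM rE -!normE rP.
Qed.

Lemma bounded_op_of_fun (f : X -> Y) (M : R) :
  (forall a x y, f (a *: x + y) = a *: f x + f y) ->
  (forall x, nrm (f x) <= M * nrm x) -> exists T : bounded_op X Y, T =1 f.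
Proof.
move=> fL fM; pose mf := GRing.isLinear.Build K X Y *:%R f fL.
pose L : {linear X -> Y} := HB.pack f mf.
suff Lc : continuous L by exists (BoundedOp Lc).
apply: bounded_linear_continuous; apply/linear_boundedP.
exists (of_real k M); split=> [|r Mr x].
  have [M0|M0] := leP 0 M.
    by apply: ger0_real; rewrite -(of_real0 R k) ler_of_real.
  by apply: ler0_real; rewrite -(of_real0 R k) ler_of_real ltW.
apply: le_trans (_ : of_real k M * `|x| <= _); last by rewrite ler_wpM2r // ltW.
by rewrite !normE -of_realM ler_of_real fM.
Qed.

Lemma zero_bounded_op : exists T : bounded_op X Y, T =1 fun=> 0.
Proof.
by apply: (@bounded_op_of_fun _ 0) => *; rewrite ?scaler0 ?addr0 ?nrm0 ?mul0r.
Qed.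

Definition real_opnorm (f : X -> Y) : R :=
  sup [set nrm (f x) | x in [set x | nrm x <= 1]].

Section RealOpnorm.
Variables (f : X -> Y) (M : R).
Hypothesis fM : forall x, nrm x <= 1 -> nrm (f x) <= M.

Lemma opnormE : opnorm f = of_real k (real_opnorm f).
Proof.
have x1 (x : X) : (`|x| <= 1) = (nrm x <= 1).
  by rewrite normE -(of_real1 R k) ler_of_real.
rewrite /opnorm (@supremum_of_real _ _ _ M).
- congr (of_real k (sup _)); apply/seteqP; split.
    by move=> _ [_ [x /= + <-] <-]; rewrite x1 => ?; exists x.
  by move=> _ [x /= nx <-]; exists `|f x| => //; exists x => //=; rewrite x1.
- by exists `|f 0|, 0 => //=; rewrite normr0.
- by move=> _ [x _ <-].
- by move=> _ [x /= + <-]; rewrite x1; exact: fM.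
Qed.

Lemma real_opnorm_ub x : nrm x <= 1 -> nrm (f x) <= real_opnorm f.
Proof.
by move=> x1; apply: ub_le_sup; [exists M => _ [z z1 <-]; exact: fM|exists x].
Qed.

End RealOpnorm.

Lemma real_opnorm_le f M :
  (forall x, nrm x <= 1 -> nrm (f x) <= M) -> real_opnorm f <= M.
Proof.
move=> fM; apply: ge_sup => [|_ [x x1 <-]]; last exact: fM.
by exists (nrm (f 0)), 0 => //=; rewrite nrm0.
Qed.

(** No boundedness enters: if there were no such [x], then [real_opnorm f - e] would bound all the
    values, hence their supremum. *)
Lemma real_opnorm_adherent f e : 0 < e ->
  exists2 x, nrm x <= 1 & real_opnorm f - e < nrm (f x).
Proof.
move=> e0; apply: contrapT => fe.
have : real_opnorm f <= real_opnorm f - e; last by lra.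
apply: real_opnorm_le => x x1; rewrite leNgt; apply/negP => fx.
by apply: fe; exists x.
Qed.

Lemma opnorm_nrm_ub (T : bounded_op X Y) x : nrm (T x) <= real_opnorm T * nrm x.
Proof.
have [->|x0] := eqVneq x 0; first by rewrite linear0 !nrm0 mulr0.
have [M M0 TM] := bounded_op_nrm T.
have nx0 : 0 < nrm x by rewrite nrm_gt0.
have xE : x = of_real k (nrm x) *: (of_real k (nrm x)^-1 *: x).
  by rewrite scalerA -of_realM mulfV ?gt_eqF // of_real1 scale1r.
rewrite {1}xE linearZ nrmZ nrm_of_real ger0_norm ?nrm_ge0 // mulrC.
rewrite ler_pM2r //; apply: (@real_opnorm_ub _ M) => [z z1|].
  by apply: le_trans (TM z) _; rewrite -{2}(mulr1 M) ler_wpM2l.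
by rewrite nrmZ nrm_of_real ger0_norm ?invr_ge0 ?nrm_ge0 // mulVf ?gt_eqF.
Qed.

Lemma real_opnorm_ge0 (T : bounded_op X Y) : 0 <= real_opnorm T.
Proof.
have [M M0 TM] := bounded_op_nrm T.
apply: le_trans (nrm_ge0 (T 0)) _; apply: (@real_opnorm_ub _ M) => [z z1|].
  by apply: le_trans (TM z) _; rewrite -{2}(mulr1 M) ler_wpM2l.
by rewrite nrm0.
Qed.

End OperatorNorm.

(** * The alternative Daugavet property in terms of real norms *)

Section AlternativeDaugavet.
Variables (R : realType) (k : scalar_kind) (X Y : normedModType (scalars R k)).
Variable G : bounded_op X Y.
Local Notation K := (scalars R k).

(** Both claims rest on one bound, [M + N], uniform in [w] and in the unit ball; it guarantees that
    all the suprema are genuine. *)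
Lemma supremum_opnorm (T : bounded_op X Y) :
  (forall (w : K) x, nrm w = 1 -> nrm x <= 1 ->
    nrm (G x + w *: T x) <=
      sup [set real_opnorm (G \+ w \*: T) | w in [set w : K | nrm w = 1]]) /\
  supremum 0 [set opnorm (G \+ w \*: T) | w in [set w : K | `|w| = 1]] =
    of_real k (sup [set real_opnorm (G \+ w \*: T) | w in [set w : K | nrm w = 1]]).
Proof.
have [M M0 GM] := bounded_op_nrm G; have [N N0 TN] := bounded_op_nrm T.
have bd (w : K) x : nrm w = 1 -> nrm x <= 1 -> nrm (G x + w *: T x) <= M + N.
  move=> w1 x1; apply: le_trans (ler_nrmD _ _) _; rewrite nrmZ w1 mul1r lerD //.
    by apply: le_trans (GM x) _; rewrite -{2}(mulr1 M) ler_wpM2l.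
  by apply: le_trans (TN x) _; rewrite -{2}(mulr1 N) ler_wpM2l.
have n1 (w : K) : (`|w| = 1) <-> (nrm w = 1).
  by rewrite normE -{1}(of_real1 R k); split=> [/(congr1 (@real_part R k))|->//];
    rewrite !of_realK.
split=> [w x w1 x1|].
  apply: le_trans (real_opnorm_ub (fun z => bd w z w1) x1) _.
  apply: ub_le_sup; last by exists w.
  exists (M + N) => _ [v /= v1 <-]; apply: real_opnorm_le => z; exact: bd.
rewrite (@supremum_of_real _ _ _ (M + N)).
- congr (of_real k (sup _)); apply/seteqP; split.
    move=> _ [_ [w /= /n1 w1 <-] <-]; exists w => //.
    by rewrite (opnormE (fun z => bd w z w1)) of_realK.
  move=> _ [w /= w1 <-]; exists (opnorm (G \+ w \*: T)).
    by exists w => //=; apply/n1.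
  by rewrite (opnormE (fun z => bd w z w1)) of_realK.
- by exists (opnorm (G \+ 1 \*: T)), 1 => //=; rewrite normr1.
- move=> _ [w /= /n1 w1 <-]; rewrite (opnormE (fun z => bd w z w1)).
  rewrite -(of_real0 R k) ler_of_real; apply: le_trans (nrm_ge0 (G 0 + w *: T 0)) _.
  by apply: (real_opnorm_ub (fun z => bd w z w1)); rewrite nrm0.
- move=> _ [w /= /n1 w1 <-]; rewrite (opnormE (fun z => bd w z w1)) of_realK.
  by apply: real_opnorm_le => z; exact: bd.
Qed.

Lemma opnorm_bounded_op (T : bounded_op X Y) : opnorm T = of_real k (real_opnorm T).
Proof.
have [M M0 TM] := bounded_op_nrm T; apply: (opnormE (M := M)) => x x1.
by apply: le_trans (TM x) _; rewrite -{2}(mulr1 M) ler_wpM2l.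
Qed.

Lemma alternative_DaugavetP :
  alternative_Daugavet G <->
  forall T : bounded_op X Y, rank_le_one T ->
    sup [set real_opnorm (G \+ w \*: T) | w in [set w : K | nrm w = 1]] =
    1 + real_opnorm T.
Proof.
split=> GD T /GD; have [_ ->] := supremum_opnorm T; rewrite opnorm_bounded_op.
  by rewrite -(of_real1 R k) -of_realD => /(congr1 (@real_part R k)); rewrite !of_realK.
by move=> ->; rewrite of_realD of_real1.
Qed.

(** The contraction estimate is the case of the zero operator, where the supremum equals 1. The
    second part unfolds the two nested suprema, over [w] and over [z]. *)
Lemma alternative_Daugavet_elim :
  alternative_Daugavet G ->
  (forall x, nrm (G x) <= nrm x) /\
  forall T : bounded_op X Y, rank_le_one T -> forall e, 0 < e ->
    exists w z, [/\ nrm w = 1, nrm z <= 1 &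
                    1 + real_opnorm T - e < nrm (G z + w *: T z)].
Proof.
move=> /alternative_DaugavetP GD; split=> [x|T /GD TE e e0].
  have [T T0] := zero_bounded_op X Y.
  have Tr : rank_le_one T by exists 0 => z; exists 0; rewrite T0 scaler0.
  have T00 : real_opnorm T = 0.
    apply: le_anti; rewrite real_opnorm_ge0 andbT.
    by apply: real_opnorm_le => z _; rewrite T0 nrm0.
  apply: le_trans (opnorm_nrm_ub G x) _; rewrite -{2}(mul1r (nrm x)).
  rewrite ler_wpM2r ?nrm_ge0 //; apply: real_opnorm_le => z z1.
  have := (supremum_opnorm T).1 1 z (nrm1 _ _) z1.
  by rewrite (GD T Tr) T0 T00 scaler0 !addr0.
have : 1 + real_opnorm T - e <
    sup [set real_opnorm (G \+ w \*: T) | w in [set w : K | nrm w = 1]].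
  by rewrite TE; lra.
move=> /sup_gt[|_ [w /= w1 <-] we].
  by exists (real_opnorm (G \+ 1 \*: T)), 1 => //=; rewrite nrm1.
have [|z z1 zP] := @real_opnorm_adherent _ _ _ _ (G \+ w \*: T)
  (real_opnorm (G \+ w \*: T) - (1 + real_opnorm T - e)); first by rewrite subr_gt0.
by exists w, z; split=> //; move: zP; rewrite /=; lra.
Qed.

(** Only the value of [T] at a single point [u] enters the criterion, so it can be checked inside a
    subspace containing [u]. The reverse inequality is the triangle inequality. *)
Lemma alternative_Daugavet_intro :
  (forall x, nrm (G x) <= nrm x) ->
  (forall T : bounded_op X Y, rank_le_one T -> forall u, nrm u <= 1 ->
    forall e, 0 < e -> exists w z, [/\ nrm w = 1, nrm z <= 1 &
      1 + nrm (T u) - e < nrm (G z + w *: T z)]) ->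
  alternative_Daugavet G.
Proof.
move=> G1 GT; apply/alternative_DaugavetP => T Tr; apply: le_anti; apply/andP; split.
  apply: ge_sup => [|_ [w /= w1 <-]].
    by exists (real_opnorm (G \+ 1 \*: T)), 1 => //=; rewrite nrm1.
  apply: real_opnorm_le => x x1; apply: le_trans (ler_nrmD _ _) _.
  rewrite nrmZ w1 mul1r lerD ?(le_trans (G1 x)) // (le_trans (opnorm_nrm_ub T x)) //.
  by rewrite -{2}(mulr1 (real_opnorm T)) ler_wpM2l // real_opnorm_ge0.
apply/ler_addgt0Pr => e e0; have e20 : 0 < e / 2 by lra.
have [u u1 Tu] := real_opnorm_adherent T e20.
have [w [z [w1 z1 wz]]] := GT T Tr u u1 _ e20.
by have := (supremum_opnorm T).1 w z w1 z1; lra.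
Qed.

End AlternativeDaugavet.

(** * Absolutely convex combinations *)

Section Combination.
Variables (R : realType) (k : scalar_kind) (X : normedModType (scalars R k)).
Local Notation K := (scalars R k).
Implicit Types s : seq (K * X).

Definition combination s : X := \sum_(i <- s) i.1 *: i.2.

Definition weight s : R := \sum_(i <- s) nrm i.1.

Lemma weight_ge0 s : 0 <= weight s.
Proof. by apply: sumr_ge0 => i _; exact: nrm_ge0. Qed.

Variables (A : set X) (D : R).
Hypothesis D0 : 0 <= D.

(** The infimum is the infimal convolution of the Minkowski gauge of the absolutely convex hull of
    [A] with [D * nrm]: what a combination misses is paid for at the rate [D], which keeps the set
    of candidates nonempty. *)
Definition gauge_candidates v : set R :=
  [set weight s + D * nrm (v - combination s) | s in
    [set s : seq (K * X) | forall i, i \in s -> A i.2]].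

(* The largest seminorm below [D * nrm] that is at most 1 on [A]. *)
Definition gauge v : R := inf (gauge_candidates v).

Lemma gauge_ub s v : (forall i, i \in s -> A i.2) ->
  gauge v <= weight s + D * nrm (v - combination s).
Proof.
move=> sA; apply: ge_inf; last by exists s.
by exists 0 => _ [t _ <-]; rewrite addr_ge0 ?weight_ge0 // mulr_ge0 // nrm_ge0.
Qed.

Lemma gauge_adherent v e : 0 < e ->
  exists2 s, forall i, i \in s -> A i.2 &
    weight s + D * nrm (v - combination s) < gauge v + e.
Proof.
rewrite -(ltrDl (gauge v)) => /inf_lt[|_ [s sA <-] sP]; last by exists s.
by exists (weight [::] + D * nrm (v - combination [::])), [::].
Qed.

Lemma gauge_le_nrm v : gauge v <= D * nrm v.
Proof.
have := @gauge_ub [::] v; rewrite /weight /combination !big_nil add0r subr0.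
by apply.
Qed.

Lemma gauge_le1 z : A z -> gauge z <= 1.
Proof.
move=> Az; have := @gauge_ub [:: (1, z)] z; rewrite /weight /combination !big_seq1 /=.
rewrite scale1r subrr nrm0 mulr0 addr0 nrm1; apply => i.
by rewrite inE => /eqP ->.
Qed.

Lemma gaugeD u v : gauge (u + v) <= gauge u + gauge v.
Proof.
apply/ler_addgt0Pr => e e0; have e20 : 0 < e / 2 by lra.
have [s sA su] := gauge_adherent u e20; have [t tA tv] := gauge_adherent v e20.
have stA i : i \in s ++ t -> A i.2 by rewrite mem_cat => /orP[/sA|/tA].
apply: le_trans (gauge_ub _ stA) _.
rewrite /weight /combination !big_cat /= -/(weight s) -/(weight t).
rewrite -/(combination s) -/(combination t) opprD addrACA.
have := ler_wpM2l D0 (ler_nrmD (u - combination s) (v - combination t)).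
by rewrite mulrDr; lra.
Qed.

Lemma gaugeZ a v : gauge (a *: v) <= nrm a * gauge v.
Proof.
have [->|a0] := eqVneq a 0.
  by rewrite scale0r nrm0 mul0r (le_trans (gauge_le_nrm _)) // nrm0 mulr0.
have na0 : 0 < nrm a by rewrite nrm_gt0.
rewrite -ler_pdivrMl //; apply/ler_addgt0Pr => e e0.
have [s sA sv] := gauge_adherent v e0; rewrite ler_pdivrMl //.
have asA i : i \in [seq (a * j.1, j.2) | j <- s] -> A i.2.
  by move=> /mapP[j /sA + ->].
apply: le_trans (gauge_ub _ asA) (le_trans _ (ler_wpM2l (ltW na0) (ltW sv))).
rewrite /weight /combination !big_map /=.
under eq_bigr do rewrite nrmM; under [X in D * nrm (_ - X)]eq_bigr do rewrite -scalerA.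
by rewrite -mulr_sumr -scaler_sumr -scalerBr nrmZ mulrCA -mulrDr.
Qed.

End Combination.

(** * The property as density of the hull of the peaks *)

Section Peaks.
Variables (R : realType) (k : scalar_kind) (X Y : normedModType (scalars R k)).
Variable G : bounded_op X Y.
Local Notation K := (scalars R k).

Definition peak (y : Y) (e : R) : set X :=
  [set z | nrm z <= 1 /\
    exists2 w : K, nrm w = 1 & 1 + nrm y - e < nrm (G z + w *: y)].

(* Geometric form of the property: the absolutely convex hull of
   [peak y e] is dense in the unit ball. *)
Definition peak_dense : Prop :=
  forall x y e, y != 0 -> 0 < e -> exists s : seq (K * X),
    [/\ forall i, i \in s -> peak y e i.2,
        weight s <= nrm x + e & nrm (x - combination s) <= e].

Lemma alternative_Daugavet_peak_dense : alternative_Daugavet G -> peak_dense.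
Proof.
move=> /alternative_Daugavet_elim[G1 GT] x y e y0 e0.
(* With this rate, a total cost below [nrm x + e] leaves an error of at most [e]. *)
pose D := (nrm x + e) / e; have xe0 : 0 < nrm x + e by rewrite ltr_wpDl ?nrm_ge0.
have D0 : 0 < D by rewrite divr_gt0.
pose p := gauge (peak y e) D.
suff px : p x <= nrm x.
  have [s sA sx] := gauge_adherent (peak y e) D x e0; exists s; split=> //.
    have := mulr_ge0 (ltW D0) (nrm_ge0 (x - combination s)).
    by move: px sx; rewrite -/p; lra.
  have : D * nrm (x - combination s) <= nrm x + e.
    by have := weight_ge0 s; move: px sx; rewrite -/p; lra.
  by rewrite -ler_pdivlMl // /D invf_div mulrVK // unitfE gt_eqF.
rewrite leNgt; apply/negP => xp.
have [F [FL Fp Fx]] :=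
  hahn_banach x (gaugeD (peak y e) (ltW D0)) (gaugeZ (peak y e) (ltW D0)).
have [T TE] : exists T : bounded_op X Y, T =1 fun z => F z *: y.
  apply: (@bounded_op_of_fun _ _ _ _ _ (D * nrm y)) => [a u v|z].
    by rewrite FL scalerDl scalerA.
  rewrite nrmZ mulrAC ler_wpM2r ?nrm_ge0 // (le_trans (Fp z)) //.
  exact/gauge_le_nrm/ltW.
have Tr : rank_le_one T by exists y => z; exists (F z); rewrite TE.
set t := real_opnorm T; have ny0 : 0 < nrm y by rewrite nrm_gt0.
have yt : nrm y < t.
  have := opnorm_nrm_ub T x; rewrite TE nrmZ -/t => Ft.
  have : nrm x * nrm y < t * nrm x.
    by apply: lt_le_trans Ft; rewrite ltr_pM2r // (lt_le_trans xp).
  have [->|x0] := eqVneq x 0; first by rewrite nrm0 mulr0 mul0r ltxx.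
  by rewrite mulrC ltr_pM2r // nrm_gt0.
(* The bound by [e] will make the witness [z] a peak; the other bound, being less than [t - nrm y],
   forces [1 < nrm (F z)]. *)
pose h := Num.min e ((t - nrm y) / 2).
have h0 : 0 < h by rewrite lt_min e0 /=; lra.
have he : h <= e by rewrite ge_min lexx.
have hty : h <= (t - nrm y) / 2 by rewrite ge_min lexx orbT.
have [w [z [w1 z1]]] := GT T Tr _ h0; rewrite TE -/t => wz.
have Fzt : nrm (F z) * nrm y <= t.
  have := opnorm_nrm_ub T z; rewrite TE nrmZ -/t => /le_trans; apply.
  by rewrite -{2}(mulr1 t) ler_wpM2l // real_opnorm_ge0.
have Fz1 : 1 < nrm (F z).
  have := ler_nrmD (G z) (w *: (F z *: y)); rewrite !nrmZ w1 mul1r => GF.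
  have := le_trans (G1 z) z1 => Gz.
  have : nrm y < nrm (F z) * nrm y by lra.
  by rewrite -{1}(mul1r (nrm y)) ltr_pM2r.
have : peak y e z.
  have [u u1 FzE] := polar_decomposition (F z).
  split=> //; exists (w * u); first by rewrite nrmM w1 u1 mul1r.
  (* Shrinking [F z] to its phase [u] costs [(nrm (F z) - 1) * nrm y], at most [t - nrm y], so more
     than [1 + nrm y - h] is left. *)
  have -> : G z + (w * u) *: y =
      G z + w *: (F z *: y) - (of_real k (nrm (F z) - 1) * (w * u)) *: y.
    rewrite scalerA -addrA -scalerBl; congr (_ + _ *: y).
    apply/eqP; rewrite eq_sym subr_eq -[X in X + _]mul1r -mulrDl.
    by rewrite -(of_real1 R k) -of_realD addrC subrK mulrCA -FzE.
  have := lerB_nrm (G z + w *: (F z *: y)) ((of_real k (nrm (F z) - 1) * (w * u)) *: y).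
  rewrite [nrm (_ *: y)]nrmZ !nrmM w1 u1 nrm_of_real gtr0_norm ?subr_gt0 // !mulr1.
  by rewrite mulrBl mul1r; lra.
by move=> /gauge_le1-/(_ D (ltW D0)); have := Fp z; lra.
Qed.

(** The lower bound on the norm of [G], again from the zero operator. It complements [peak_dense],
    which concerns nonzero [y]. *)
Lemma alternative_Daugavet_norming : alternative_Daugavet G ->
  forall e, 0 < e -> exists2 z, nrm z <= 1 & 1 - e < nrm (G z).
Proof.
move=> /alternative_Daugavet_elim[_ GT] e e0.
have [T T0] := zero_bounded_op X Y.
have Tr : rank_le_one T by exists 0 => z; exists 0; rewrite T0 scaler0.
have [w [z [_ z1]]] := GT T Tr e e0; rewrite T0 scaler0 addr0 => zP.
by exists z => //; have := real_opnorm_ge0 T; lra.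
Qed.

Lemma peak_dense_alternative_Daugavet :
  (forall x, nrm (G x) <= nrm x) ->
  (forall e, 0 < e -> exists2 z, nrm z <= 1 & 1 - e < nrm (G z)) ->
  peak_dense -> alternative_Daugavet G.
Proof.
move=> G1 Gn Gp; apply: alternative_Daugavet_intro => // T [y0 Ty0] u u1 e e0.
have [Tu0|Tu0] := eqVneq (T u) 0.
  have [z z1 zP] := Gn e e0; rewrite Tu0 nrm0 addr0.
  (* [G z] is the midpoint of [G z + T z] and [G z - T z], so one of the rotations 1 and -1
     works. *)
  have := ler_nrmD (G z + T z) (G z - T z); rewrite addrACA subrr addr0.
  have -> : G z + G z = of_real k 2 *: G z.
    by rewrite of_realD of_real1 scalerDl scale1r.
  rewrite nrmZ nrm_of_real ger0_norm //.
  have [Tz _|Tz Tz2] := ltP (1 - e) (nrm (G z + T z)).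
    by exists 1, z; rewrite nrm1 scale1r.
  by exists (-1), z; rewrite nrmN nrm1 scaleN1r; split=> //; lra.
set y := T u in Tu0 *; have b0 : 0 < nrm y by rewrite nrm_gt0.
have [M M0 TM] := bounded_op_nrm T.
(* [h] is the loss allowed in [nrm (T z)]. With [d * (M + nrm y + 1) = h], the bound
   [M * d + (1 + d) * (nrm y - h)] equals [nrm y - d - d * h], strictly below [nrm y]. *)
pose h := Num.min (e / 2) (nrm y).
have h0 : 0 < h by rewrite lt_min b0 andbT; lra.
have he : h <= e / 2 by rewrite ge_min lexx.
have hy : h <= nrm y by rewrite ge_min lexx orbT.
have Myr : 0 < M + nrm y + 1 by lra.
pose d := h / (M + nrm y + 1); have d0 : 0 < d by rewrite divr_gt0.
have dE : d * (M + nrm y + 1) = h by rewrite divfK ?gt_eqF.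
have dh : d <= h by rewrite -dE ler_peMr ?ltW //; lra.
have [s [sP sw su]] := Gp u y d Tu0 d0.
(* Averaging: if [T] were at most [nrm y - h] at every entry, [T u] would have norm less than
   [nrm y]. *)
have [i si Ti] : exists2 i, i \in s & nrm y - h < nrm (T i.2).
  apply: contrapT => nTi.
  have Ts : nrm (T (combination s)) <= weight s * (nrm y - h).
    rewrite /combination /weight mulr_suml linear_sum.
    rewrite big_seq [leRHS]big_seq; elim/big_ind2 : _ => [|x r x' r' xr xr'|j sj].
    - by rewrite nrm0.
    - by apply: le_trans (ler_nrmD _ _) _; rewrite lerD.
    rewrite linearZ nrmZ ler_wpM2l ?nrm_ge0 // leNgt; apply/negP => Tj.
    by apply: nTi; exists j.
  have : nrm y <= M * d + (1 + d) * (nrm y - h); last by nra.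
  rewrite {1}/y -(subrK (combination s) u) linearD (le_trans (ler_nrmD _ _)) // lerD //.
    by apply: le_trans (TM _) _; rewrite ler_wpM2l.
  by apply: le_trans Ts _; rewrite ler_wpM2r ?subr_ge0 //; lra.
have [z1 [w w1 wP]] := sP i si; move: (i.2) z1 wP Ti => z z1 wP Tz {si sP}.
have [c Tzc] : exists c, T z = c *: y.
  have [[cz ->] [cu yE]] := (Ty0 z, Ty0 u); rewrite -/y in yE.
  exists (cz / cu); rewrite yE scalerA divfK //.
  by apply: contraNneq Tu0 => cu0; rewrite yE cu0 scale0r.
have [v v1 cE] := polar_decomposition c.
(* Dividing by the phase [v] of [c] aligns [T z] with the direction [w *: y] in which [z] is a
   peak. *)
exists (w / v), z; split=> //; first by rewrite nrmM nrmV w1 v1 divr1.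
have v0 : v != 0 by rewrite -nrm_eq0 v1 oner_eq0.
have -> : (w / v) *: T z = of_real k (nrm c) *: (w *: y).
  by rewrite Tzc {1}cE !scalerA mulrCA divfK.
rewrite Tzc nrmZ in Tz; have nwy : nrm (w *: y) = nrm y by rewrite nrmZ w1 mul1r.
(* If |c| >= 1, subtract (|c| - 1) G z from |c| (G z + w y): at least 1 + |c| (|y| - d) remains, and
   d <= |y|. If |c| < 1, subtract (1 - |c|) w y from G z + w y: more than 1 - d + |c| |y| remains,
   and |c| |y| > |y| - h. *)
have [c1|c1] := leP 1 (nrm c).
  have := lerB_nrm (of_real k (nrm c) *: (G z + w *: y)) (of_real k (nrm c - 1) *: G z).
  rewrite !nrmZ !nrm_of_real (ger0_norm (nrm_ge0 c)).
  rewrite (ger0_norm (_ : 0 <= nrm c - 1)) ?subr_ge0 //.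
  have -> : of_real k (nrm c) *: (G z + w *: y) - of_real k (nrm c - 1) *: G z =
      G z + of_real k (nrm c) *: (w *: y).
    rewrite scalerDr addrAC -scalerBl of_realB of_real1 opprB addrCA subrr.
    by rewrite addr0 scale1r.
  have c0 : 0 <= nrm c - 1 by rewrite subr_ge0.
  have := ler_wpM2l c0 (le_trans (G1 z) z1); have := ler_wpM2l (nrm_ge0 c) (ltW wP).
  have yd : 0 <= nrm y - d by lra.
  have := mulr_ge0 c0 yd; lra.
have := lerB_nrm (G z + w *: y) (of_real k (1 - nrm c) *: (w *: y)).
rewrite [nrm (_ *: (w *: y))]nrmZ nwy nrm_of_real gtr0_norm ?subr_gt0 //.
have -> : G z + w *: y - of_real k (1 - nrm c) *: (w *: y) =
    G z + of_real k (nrm c) *: (w *: y).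
  by rewrite -addrA of_realB of_real1 scalerBl scale1r opprB [X in _ + X]addrC subrK.
by rewrite mulrBl mul1r; lra.
Qed.

End Peaks.

(** * Separable subspaces *)

Section Closure.
Variables (R : realType) (k : scalar_kind) (V : normedModType (scalars R k)).

Lemma nbhs_nrmP (x : V) (P : set V) :
  nbhs x P <-> exists2 e, 0 < e & forall y, nrm (x - y) < e -> P y.
Proof.
split=> [/nbhs_normP[e /= e0 eP]|[e e0 eP]].
  have eE := ge0_of_real (ltW e0); exists (real_part e) => [|y xy].
    by rewrite -(ltr_of_real k) eE of_real0.
  by apply: eP; rewrite /ball_/= normE -eE ltr_of_real.
apply/nbhs_normP; exists (of_real k e) => /=.
  by rewrite -(of_real0 R k) ltr_of_real.
by move=> y; rewrite /ball_/= normE ltr_of_real; exact: eP.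
Qed.

Lemma closure_nrmP (D : set V) (x : V) :
  closure D x <-> forall e, 0 < e -> exists2 d, D d & nrm (x - d) < e.
Proof.
split=> [Dx e e0|Dx B /nbhs_nrmP[e e0 eB]].
  have [|d [Dd xd]] := Dx [set y | nrm (x - y) < e]; last by exists d.
  by apply/nbhs_nrmP; exists e.
by have [d Dd xd] := Dx e e0; exists d; split=> //; exact: eB.
Qed.
End Closure.

Section Subspaces.
Variables (R : realType) (k : scalar_kind) (V : normedModType (scalars R k)).
Local Notation K := (scalars R k).

Lemma separable_countable (S : closed_subspace V) : separable S ->
  exists2 C : set V, countable C & subspace_set S `<=` closure C.
Proof.
move=> [C Cc Cd]; exists [set subspace_val x | x in C].
  by apply: sub_countable Cc; exact: card_image_le.
move=> x Sx; apply/closure_nrmP => e e0.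
pose x' : S := SubspaceElt (mem_set Sx : x \in subspace_pred S).
have [|d [xd Cd']] := Cd (interior [set y : S | nrm (x' - y) < e]) _ (open_interior _).
  by exists x'; apply/nbhs_nrmP; exists e.
exists (subspace_val d); first by exists d.
exact: (interior_subset xd).
Qed.

(** Scalar multiplication is continuous, so closure under the dense multiples [q n] suffices for a
    subspace; [D] itself is dense in it. *)
Lemma separable_subspace_closure (q : nat -> K) (D : set V) :
  (forall c e, 0 < e -> exists n, nrm (c - q n) < e) ->
  countable D -> D 0 -> (forall x y, D x -> D y -> D (x + y)) ->
  (forall n x, D x -> D (q n *: x)) ->
  exists2 S : closed_subspace V, separable S & subspace_set S = closure D.
Proof.
move=> qd Dc D0 DD Dq.
have cD : submod_closed (mem (closure D)).
  have DE x : (x \in mem (closure D)) = (x \in closure D) by [].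
  split; first by rewrite DE inE; exact: subset_closure.
  move=> a x y; rewrite !DE !inE => /closure_nrmP Dx /closure_nrmP Dy.
  apply/closure_nrmP => e e0; have e30 : 0 < e / 3 by lra.
  have nx := nrm_ge0 x; have na := nrm_ge0 a.
  (* The order matters: the tolerance for [q n] depends on [x], and that for [x'] on [q n]. Adding 1
     keeps the denominators positive. *)
  have [n an] := qd a _ (divr_gt0 e30 (ltr_wpDl nx ltr01)).
  have nq := nrm_ge0 (q n).
  have [x' Dx' xx'] := Dx _ (divr_gt0 e30 (ltr_wpDl nq ltr01)).
  have [y' Dy' yy'] := Dy _ e30; exists (q n *: x' + y'); first exact/DD/Dy'/Dq.
  have -> : a *: x + y - (q n *: x' + y') =
      ((a - q n) *: x + q n *: (x - x')) + (y - y').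
    rewrite opprD addrACA scalerBl scalerBr; congr (_ + _).
    by rewrite addrA subrK.
  apply: le_lt_trans (ler_nrmD _ _) _.
  apply: le_lt_trans (lerD (ler_nrmD _ _) (lexx _)) _; rewrite !nrmZ.
  move: an xx'; rewrite (ltr_pdivlMr _ _ (ltr_wpDl nx ltr01)).
  rewrite (ltr_pdivlMr _ _ (ltr_wpDl nq ltr01)).
  have := nrm_ge0 (a - q n); have := nrm_ge0 (x - x'); nra.
exists (ClosedSubspace cD (@closed_closure _ _)) => //.
set S := ClosedSubspace _ _; exists [set x : S | D (subspace_val x)].
  have /countable_injP[f] := Dc => fi.
  apply/countable_injP; exists (f \o (@subspace_val _ _ S)) => x y.
  rewrite !inE /= => Dx Dy xy; apply: val_inj; apply: fi => //; exact/mem_set.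
move=> O [x Ox] Oo; have /nbhs_nrmP[e e0 eO] : nbhs x O by exact: open_nbhs_nbhs.
have /closure_nrmP/(_ e e0)[d Dd xd] : closure D (subspace_val x).
  exact: (set_mem (subspace_valP x)).
have Sd : d \in subspace_pred S by apply: mem_set; exact: subset_closure.
by exists (SubspaceElt Sd); split=> //; exact: eO.
Qed.

End Subspaces.

(** Iterate one-step closures and take the union: two arguments always lie in a common stage.
    Operations of lower arity are passed as binary ones that ignore arguments. *)
Lemma countable_closed_under (I : countType) (T : Type) (op : I -> T -> T -> T)
    (A : set T) : countable A ->
  exists D : set T, [/\ countable D, A `<=` D &
    forall i x y, D x -> D y -> D (op i x y)].
Proof.
move=> Ac; pose step D := D `|` \bigcup_i [set op i p.1 p.2 | p in D `*` D].
pose D n := iter n step A.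
have DS n m : (n <= m)%N -> D n `<=` D m.
  by move=> /subnK <-; elim: (m - n)%N => // j IH x /IH; left.
exists (\bigcup_n D n); split.
- apply: bigcup_countable => // n _; elim: n => //= n IH.
  have -> : step (D n) = \bigcup_(b : bool) (if b then D n else
      \bigcup_i [set op i p.1 p.2 | p in D n `*` D n]).
    apply/seteqP; split=> [x [Dx|Dx]|x [[] _]]; [exists true|exists false| |] => //.
      by left.
    by right.
  apply: bigcup_countable => // -[] _ //; apply: bigcup_countable => // i _.
  by apply: sub_countable (countableX IH IH); exact: card_image_le.
- by move=> x Ax; exists 0%N.
- move=> i x y [n _ Dx] [m _ Dy]; exists (maxn n m).+1 => //; right; exists i => //.
  exists (x, y) => //; split; first by apply: DS Dx; exact: leq_maxl.
  by apply: DS Dy; exact: leq_maxr.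
Qed.

Lemma separable_subspace_containing (R : realType) (k : scalar_kind)
    (V : normedModType (scalars R k)) (v : V) :
  exists2 S : closed_subspace V, separable S & subspace_set S v.
Proof.
have [q qd] := countable_dense_scalars R k.
pose op (i : option nat) (x y : V) := if i is Some n then q n *: x else x + y.
have [|D [Dc AD Dop]] := @countable_closed_under _ _ op [set 0; v].
  by apply: finite_set_countable; exact: finite_set2.
have [|x y Dx Dy|n x Dx|S Ss SD] := separable_subspace_closure qd Dc.
- by apply: AD; left.
- exact: (Dop None).
- exact: (Dop (Some n) x x).
- by exists S => //; rewrite SD; apply/subset_closure/AD; right.
Qed.

Section Restriction.
Variables (R : realType) (k : scalar_kind) (X Y : normedModType (scalars R k)).
Variables (G : bounded_op X Y) (S : closed_subspace X) (S' : closed_subspace Y).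
Hypothesis GS : G @` subspace_set S `<=` subspace_set S'.
Local Notation K := (scalars R k).

Lemma restrict_peak_dense (C : set X) (C' : set Y) :
  C `<=` subspace_set S ->
  subspace_set S `<=` closure C -> subspace_set S' `<=` closure C' ->
  (forall x y e, C x -> C' y -> y != 0 -> 0 < e -> exists s : seq (K * X),
    [/\ forall i, i \in s -> C i.2 /\ peak G y e i.2,
        weight s <= nrm x + e & nrm (x - combination s) <= e]) ->
  peak_dense (restrict GS).
Proof.
move=> CS SC SC' GC x y e y0 e0.
have ny0 : 0 < nrm y by rewrite nrm_gt0.
(* A peak condition loses [h] three times: in its own tolerance, in [nrm b] and in replacing [b] by
   [y]. The bound by [nrm y] ensures [b != 0]. *)
pose h := Num.min (e / 3) (nrm y).
have h0 : 0 < h by rewrite lt_min ny0 andbT; lra.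
have he : h <= e / 3 by rewrite ge_min lexx.
have hy : h <= nrm y by rewrite ge_min lexx orbT.
have /closure_nrmP/(_ h h0)[d Cd xd] := SC _ (set_mem (subspace_valP x)).
have /closure_nrmP/(_ h h0)[b Cb yb] := SC' _ (set_mem (subspace_valP y)).
have nyb := lerB_nrm (subspace_val y) b.
rewrite -[nrm (subspace_val y)]/(nrm y) in nyb.
have b0 : b != 0 by rewrite -nrm_gt0; move: nyb; rewrite lerBlDr => nyb; lra.
have [s [sP sw sd]] := GC d b h Cd Cb b0 h0.
(* The default 0 of [insubd] never occurs on entries of [s], which lie in [C] and hence in [S]. *)
pose lft (i : K * X) : K * S := (i.1, insubd 0 i.2).
have liftK i : i \in s -> subspace_val (insubd (0 : S) i.2) = i.2.
  by move=> /sP[/CS Si _]; apply: (@insubdK _ _ S); exact: mem_set.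
exists (map lft s); split.
- move=> _ /mapP[i si ->] /=; have [_ [i1 [w w1 wP]]] := sP i si.
  split; first by rewrite /nrm /= -[`|_|]/(`|subspace_val (insubd (0 : S) i.2)|) liftK.
  exists w => //; rewrite -[nrm (_ + _)]/(nrm
    (G (subspace_val (insubd (0 : S) i.2)) + w *: subspace_val y)) liftK //.
  have := lerB_nrm (G i.2 + w *: b) (w *: (b - subspace_val y)).
  rewrite nrmZ w1 mul1r scalerBr opprB -addrA [w *: b + _]addrC subrK.
  by rewrite (nrmB b); lra.
- rewrite /weight big_map /= -/(weight s).
  have := lerB_nrm d (subspace_val x); rewrite nrmB -[nrm (subspace_val x)]/(nrm x).
  by move: xd sw; lra.
rewrite -[nrm _]/(nrm (subspace_val x - subspace_val (combination (map lft s)))).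
have -> : subspace_val (combination (map lft s)) = combination s.
  rewrite /combination big_map.
  rewrite (big_morph (@subspace_val _ _ S) (fun _ _ => erefl) erefl).
  by apply: eq_big_seq => i si /=; rewrite -[LHS]/(i.1 *: subspace_val _) liftK.
have := ler_nrmD (subspace_val x - d) (d - combination s); rewrite addrA subrK.
by move: xd sd; lra.
Qed.

End Restriction.

(** * Separable reduction and its converse *)

Section Reduction.
Variables (R : realType) (k : scalar_kind) (X Y : normedModType (scalars R k)).
Variable G : bounded_op X Y.
Local Notation K := (scalars R k).

Lemma alternative_Daugavet_separable_reduction
    (X0 : closed_subspace X) (Y0 : closed_subspace Y) :
  alternative_Daugavet G -> separable X0 -> separable Y0 ->
  exists (Xoo : closed_subspace X) (Yoo : closed_subspace Y),
    [/\ separable Xoo, separable Yoo,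
        subspace_set X0 `<=` subspace_set Xoo,
        subspace_set Y0 `<=` subspace_set Yoo
      & exists GXY : G @` subspace_set Xoo `<=` subspace_set Yoo,
          alternative_Daugavet (restrict GXY)].
Proof.
move=> GD /separable_countable[CX CXc X0C] /separable_countable[CY CYc Y0C].
have [G1 _] := alternative_Daugavet_elim GD.
have [q qd] := countable_dense_scalars R k.
have eN (n : nat) : 0 < n.+1%:R^-1 :> R by rewrite invr_gt0 ltr0n.
have small (e : R) : 0 < e -> exists n : nat, n.+1%:R^-1 < e.
  by move=> /ltr_add_invr[n]; rewrite add0r; exists n.
have /choice[zn znP] (n : nat) : exists z, nrm z <= 1 /\ 1 - n.+1%:R^-1 < nrm (G z).
  by have [z z1 zP] := alternative_Daugavet_norming GD (eN n); exists z.
have /choice[wit witP] (p : X * Y * nat) : exists s : seq (K * X), p.1.2 != 0 ->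
    [/\ forall i, i \in s -> peak G p.1.2 p.2.+1%:R^-1 i.2,
        weight s <= nrm p.1.1 + p.2.+1%:R^-1 &
        nrm (p.1.1 - combination s) <= p.2.+1%:R^-1].
  have [y0|y0] := eqVneq p.1.2 0; first by exists [::].
  have [s sP] := alternative_Daugavet_peak_dense GD p.1.1 y0 (eN p.2).
  by exists s.
(* Working with pairs closes both sides at once. The cases are sums, dense multiples, entries of the
   witness lists, nearly norming points, and images under [G]; beyond the end of a list, [nth]
   merely yields 0. *)
pose op (i : nat * nat * nat) (z t : X * Y) : X * Y :=
  match i.1.1 with
  | 0%N => (z.1 + t.1, z.2 + t.2)
  | 1%N => (q i.1.2 *: z.1, q i.1.2 *: z.2)
  | 2%N => ((nth (0, 0) (wit (z.1, t.2, i.1.2)) i.2).2, 0)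
  | 3%N => (zn i.1.2, 0)
  | _ => (0, G z.1)
  end.
have [D [Dc AD Dop]] := countable_closed_under op (countableX CXc CYc).
have X00 : subspace_set X0 0 := set_mem (subspace_valP (0 : X0)).
have Y00 : subspace_set Y0 0 := set_mem (subspace_valP (0 : Y0)).
(* [CX] and [CY] are nonempty, as their closures contain 0; [x] and [y] serve to complete points to
   pairs. *)
have /closure_nrmP/(_ 1 ltr01)[x Cx _] := X0C _ X00.
have /closure_nrmP/(_ 1 ltr01)[y Cy _] := Y0C _ Y00.
have D0 : D (0, 0).
  have Dxy : D (x, y) by exact: AD.
  (* Applying this operation twice gives first [(0, G x)], then [(0, G 0)]. *)
  have DG := Dop (4, 0, 0)%N _ _ Dxy Dxy.
  by have := Dop (4, 0, 0)%N _ _ DG DG; rewrite /op /= linear0.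
pose DX := [set z.1 | z in D]; pose DY := [set z.2 | z in D].
have DXc : countable DX by apply: sub_countable Dc; exact: card_image_le.
have DYc : countable DY by apply: sub_countable Dc; exact: card_image_le.
have [||n _ [z Dz <-]|Xoo Xs XE] := separable_subspace_closure qd DXc.
- by exists (0, 0).
- by move=> _ _ [z Dz <-] [t Dt <-]; exists (op (0, 0, 0)%N z t) => //; exact: Dop.
- by exists (op (1, n, 0)%N z z) => //; exact: Dop.
have [||n _ [z Dz <-]|Yoo Ys YE] := separable_subspace_closure qd DYc.
- by exists (0, 0).
- by move=> _ _ [z Dz <-] [t Dt <-]; exists (op (0, 0, 0)%N z t) => //; exact: Dop.
- by exists (op (1, n, 0)%N z z) => //; exact: Dop.
have CXD : CX `<=` DX by move=> x' Cx'; exists (x', y) => //; exact: AD.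
have CYD : CY `<=` DY by move=> y' Cy'; exists (x, y') => //; exact: AD.
have GXY : G @` subspace_set Xoo `<=` subspace_set Yoo.
  move=> _ [x1 + <-]; rewrite XE YE => /closure_nrmP Dx; apply/closure_nrmP => e e0.
  have [_ [z Dz <-] xz] := Dx e e0; exists (G z.1).
    by exists (op (4, 0, 0)%N z z) => //; exact: Dop.
  by rewrite -linearB; exact: le_lt_trans (G1 _) xz.
exists Xoo, Yoo; split=> //.
- by rewrite XE; apply: subset_trans X0C (closureS CXD).
- by rewrite YE; apply: subset_trans Y0C (closureS CYD).
have DXoo : DX `<=` subspace_set Xoo by rewrite XE; exact: subset_closure.
exists GXY; apply: peak_dense_alternative_Daugavet => [x1|e e0|].
- exact: G1.
- have [n ne] := small e e0; have [z1 zP] := znP n.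
  have Xz : zn n \in subspace_pred Xoo.
    by apply/mem_set/DXoo; exists (op (3, n, 0)%N (0, 0) (0, 0)) => //; exact: Dop.
  exists (SubspaceElt Xz) => //; suff : 1 - e < nrm (G (zn n)) by [].
  by apply: lt_trans zP; rewrite ltrD2l ltrN2.
have XD : subspace_set Xoo `<=` closure DX by rewrite XE.
have YD : subspace_set Yoo `<=` closure DY by rewrite YE.
apply: (restrict_peak_dense GXY DXoo XD YD).
move=> _ _ e [z Dz <-] [t Dt <-] t0 e0; have [n ne] := small e e0.
have [sP sw sd] := witP (z.1, t.2, n) t0; exists (wit (z.1, t.2, n)); split.
- move=> i si; split.
    exists (op (2, n, index i (wit (z.1, t.2, n)))%N z t); first exact: Dop.
    by rewrite /op /= nth_index.
  have [i1 [w w1 wP]] := sP i si; split=> //; exists w => //.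
  by apply: lt_trans wP; rewrite ltrD2l ltrN2.
- by apply: le_trans sw _; rewrite /= lerD2l ltW.
- by apply: le_trans sd _; rewrite /= ltW.
Qed.

Lemma alternative_Daugavet_of_separable :
  (forall (X0 : closed_subspace X) (Y0 : closed_subspace Y),
    separable X0 -> separable Y0 ->
    exists (Xoo : closed_subspace X) (Yoo : closed_subspace Y),
      [/\ separable Xoo, separable Yoo,
          subspace_set X0 `<=` subspace_set Xoo,
          subspace_set Y0 `<=` subspace_set Yoo
        & exists GXY : G @` subspace_set Xoo `<=` subspace_set Yoo,
            alternative_Daugavet (restrict GXY)]) ->
  alternative_Daugavet G.
Proof.
move=> GD; have {}GD (x : X) (y : Y) : exists (S : closed_subspace X)
    (S' : closed_subspace Y) (GS : G @` subspace_set S `<=` subspace_set S'),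
    [/\ subspace_set S x, subspace_set S' y & alternative_Daugavet (restrict GS)].
  have [X0 sX0 X0x] := separable_subspace_containing x.
  have [Y0 sY0 Y0y] := separable_subspace_containing y.
  have [S [S' [_ _ XS YS' [GS Gad]]]] := GD X0 Y0 sX0 sY0.
  by exists S, S', GS; split=> //; [exact: XS|exact: YS'].
apply: alternative_Daugavet_intro => [x|T [y Ty] u u1 e e0].
  have [S [S' [GS [Sx _ /alternative_Daugavet_elim[G1 _]]]]] := GD x 0.
  exact: (G1 (SubspaceElt (mem_set Sx : x \in subspace_pred S))).
have [S [S' [GS [Su Sy /alternative_Daugavet_elim[_ GT]]]]] := GD u y.
have S'y : y \in subspace_pred S' by exact: mem_set.
have TS : T @` subspace_set S `<=` subspace_set S'.
  move=> _ [x _ <-]; have [c ->] := Ty x.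
  exact: (set_mem (subspace_valP (c *: SubspaceElt S'y))).
have Tr : rank_le_one (restrict TS).
  exists (SubspaceElt S'y) => x; have [c Tc] := Ty (subspace_val x).
  by exists c; apply: val_inj; rewrite /= Tc.
have [w [z [w1 z1 wz]]] := GT _ Tr e e0.
exists w, (subspace_val z); split=> //; apply: le_lt_trans wz.
pose u' : S := SubspaceElt (mem_set Su : u \in subspace_pred S).
(* Since [u] lies in [S] and its unit ball, the restricted operator still has norm at least
   [nrm (T u)]. *)
have := opnorm_nrm_ub (restrict TS) u'; rewrite -[nrm (restrict _ _)]/(nrm (T u)).
have := real_opnorm_ge0 (restrict TS); rewrite -[nrm u']/(nrm u).
by move: u1; nra.
Qed.

End Reduction.

Theorem proposition3p7 (R : realType) (k : scalar_kind)
    (X Y : completeNormedModType (scalars R k)) (G : bounded_op X Y) :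
  alternative_Daugavet G <->
  forall (X0 : closed_subspace X) (Y0 : closed_subspace Y),
    separable X0 -> separable Y0 ->
    exists (Xoo : closed_subspace X) (Yoo : closed_subspace Y),
      [/\ separable Xoo, separable Yoo,
          subspace_set X0 `<=` subspace_set Xoo,
          subspace_set Y0 `<=` subspace_set Yoo
        & exists GXY : G @` subspace_set Xoo `<=` subspace_set Yoo,
            alternative_Daugavet (restrict GXY)].
Proof.
split=> [GD X0 Y0|]; last exact: alternative_Daugavet_of_separable.
exact: alternative_Daugavet_separable_reduction.
Qed.
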